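(* Let $s\ge0$ be an integer. For $n\ge0$ let $S_s(n)$ be the number of $\approx_s$-classes of $\{\mathtt a,\mathtt b\}^n$ having exactly one element, and let $\mathcal S_s(x)=\sum_{n\ge0}S_s(n)x^n$. Then $$\mathcal S_s(x)=\sum_{j=0}^{s}\frac{x^j}{(1-x)^{j+1}}+\frac{x^{s+1}(1+x)(1+2x^2)}{(1-x)^{s+2}}.$$
   Context: For words over $\{\mathtt a,\mathtt b\}$, $|w|_{\mathtt a}$ is the number of letters $\mathtt a$ in $w$ and $\binom{w}{\mathtt{ab}}$ the number of occurrences of $\mathtt{ab}$ as a scattered subword. For $u,w\in\{\mathtt a,\mathtt b\}^n$: $u\sim_2w$ iff $|u|_{\mathtt a}=|w|_{\mathtt a}$ and $\binom{u}{\mathtt{ab}}=\binom{w}{\mathtt{ab}}$. Let $r_i$ be the number of $\mathtt b$'s to the right of the $i$-th $\mathtt a$ of $w$, and $\ell=\min(s,|w|_{\mathtt a})$; the $s$-tail is $\mathcal T_s(w)=(r_{|w|_{\mathtt a}},r_{|w|_{\mathtt a}-1},\dots,r_{|w|_{\mathtt a}-\ell+1})$ (empty if $\ell=0$). Define $u\approx_sw$ iff $u\sim_2w$ and $\mathcal T_s(u)=\mathcal T_s(w)$. The identity is one of formal power series in $x$. *)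

(* Defs.v *)
From HB Require Import structures.
From mathcomp Require Import all_boot all_order all_algebra.
From mathcomp Require Import boolp.

Set Implicit Arguments.
Unset Strict Implicit.
Unset Printing Implicit Defensive.

Import GRing.Theory.

(* The library has no formal power series. *)
Section FormalPowerSeries.
Local Open Scope ring_scope.

Record fps (R : Type) := Fps { fcoef : nat -> R }.

Lemma fpsP (R : Type) (f g : fps R) : fcoef f =1 fcoef g -> f = g.
Proof. by case: f g => [f] [g] /= /funext ->. Qed.

HB.instance Definition _ (R : Type) := gen_eqMixin (fps R).
HB.instance Definition _ (R : Type) := gen_choiceMixin (fps R).

Section Zmodule.
Variable R : zmodType.
Implicit Types f g h : fps R.

Definition fps0 : fps R := Fps (fun=> 0).
Definition fps_add f g := Fps (fun n => fcoef f n + fcoef g n).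
Definition fps_opp f := Fps (fun n => - fcoef f n).

Lemma fps_addA : associative fps_add.
Proof. by move=> f g h; apply: fpsP => n; apply: addrA. Qed.
Lemma fps_addC : commutative fps_add.
Proof. by move=> f g; apply: fpsP => n; apply: addrC. Qed.
Lemma fps_add0 : left_id fps0 fps_add.
Proof. by move=> f; apply: fpsP => n; apply: add0r. Qed.
Lemma fps_addN : left_inverse fps0 fps_opp fps_add.
Proof. by move=> f; apply: fpsP => n; apply: addNr. Qed.

HB.instance Definition _ :=
  GRing.isZmodule.Build (fps R) fps_addA fps_addC fps_add0 fps_addN.
End Zmodule.

Section ComRing.
Variable R : comNzRingType.
Implicit Types f g h : fps R.

Definition fps1 : fps R := Fps (fun n => (n == 0%N)%:R).
Definition fps_mul f g :=
  Fps (fun n => \sum_(i < n.+1) fcoef f i * fcoef g (n - i)).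

Let trunc m f : {poly R} := \poly_(i < m.+1) fcoef f i.

Let trunc_mul m n f g : (n <= m)%N ->
  fcoef (fps_mul f g) n = (trunc m f * trunc m g)`_n.
Proof.
move=> le_nm; rewrite coefM; apply: eq_bigr => i _.
rewrite !coef_poly !ltnS (leq_trans (leq_subr _ _) le_nm).
by rewrite (leq_trans _ le_nm) // -ltnS.
Qed.

Lemma fps_mulC : commutative fps_mul.
Proof.
by move=> f g; apply: fpsP => n; rewrite !(@trunc_mul n) // mulrC.
Qed.

Lemma fps_mulA : associative fps_mul.
Proof.
move=> f g h; apply: fpsP => n.
have -> : fcoef (fps_mul f (fps_mul g h)) n
          = (trunc n f * (trunc n g * trunc n h))`_n.
  rewrite coefM; apply: eq_bigr => i _; rewrite coef_poly ltn_ord.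
  by rewrite (@trunc_mul n) // leq_subr.
rewrite mulrA coefM; apply: eq_bigr => i _.
rewrite coef_poly ltnS leq_subr.
by rewrite (@trunc_mul n) // -ltnS.
Qed.

Lemma fps_mul1 : left_id fps1 fps_mul.
Proof.
move=> f; apply: fpsP => n /=.
rewrite big_ord_recl mul1r subn0 big1 ?addr0 // => i _.
by rewrite mul0r.
Qed.

Lemma fps_mulDl : left_distributive fps_mul +%R.
Proof.
move=> f g h; apply: fpsP => n /=; rewrite -big_split.
by apply: eq_bigr => i _; rewrite mulrDl.
Qed.

Lemma fps1_neq0 : fps1 != 0.
Proof.
apply/eqP => /(congr1 (fun f => fcoef f 0)) /= /eqP.
by rewrite oner_eq0.
Qed.

HB.instance Definition _ := GRing.Zmodule_isComNzRing.Build (fps R)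
  fps_mulA fps_mulC fps_mul1 fps_mulDl fps1_neq0.

Definition fpsX : fps R := Fps (fun n => (n == 1%N)%:R).
End ComRing.

Section UnitRing.
Variable R : comUnitRingType.
Implicit Types f g : fps R.

Definition fps_unit : {pred fps R} := [pred f | fcoef f 0 \is a GRing.unit].

(* The first n.+1 coefficients of the inverse, obtained by solving
   (f * g)_k = 0 for g_k, k > 0. *)
Fixpoint fps_inv_seq f n : seq R :=
  if n is m.+1 then
    let s := fps_inv_seq f m in
    rcons s (- (fcoef f 0)^-1 * \sum_(i < m.+1) s`_i * fcoef f (m.+1 - i))
  else [:: (fcoef f 0)^-1].

Definition fps_inv f : fps R :=
  if f \in fps_unit then Fps (fun n => (fps_inv_seq f n)`_n) else f.

Let size_inv f n : size (fps_inv_seq f n) = n.+1.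
Proof. by elim: n => //= n IHn; rewrite size_rcons IHn. Qed.

Let nth_inv f n i : (i <= n)%N ->
  (fps_inv_seq f n)`_i = (fps_inv_seq f i)`_i.
Proof.
elim: n => [|n IHn]; first by rewrite leqn0 => /eqP->.
rewrite leq_eqVlt => /predU1P[-> //|lt_in].
by rewrite [LHS]nth_rcons size_inv lt_in IHn.
Qed.

Lemma fps_mulV : {in fps_unit, left_inverse 1 fps_inv *%R}.
Proof.
move=> f Uf; rewrite /fps_inv Uf; apply: fpsP => -[|n].
  by rewrite [LHS]big_ord1 /= mulVr.
rewrite [LHS]big_ord_recr subnn [fcoef (Fps _) _]/=.
rewrite nth_rcons size_inv ltnn eqxx.
rewrite mulrAC mulNr mulVr // mulN1r; apply/eqP; rewrite subr_eq0; apply/eqP.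
by apply: eq_bigr => i _; rewrite /= (@nth_inv f n) // -ltnS.
Qed.

Lemma fps_unitPl f g : g * f = 1 -> fps_unit f.
Proof.
move=> /(congr1 (fun h => fcoef h 0)); rewrite [LHS]big_ord1 /= => gf1.
by apply/unitrPr; exists (fcoef g 0); rewrite mulrC.
Qed.

Lemma fps_inv_out : {in [predC fps_unit], fps_inv =1 id}.
Proof. by move=> f /negPf nUf; rewrite /fps_inv nUf. Qed.

HB.instance Definition _ := GRing.ComNzRing_hasMulInverse.Build (fps R)
  fps_mulV fps_unitPl fps_inv_out.
End UnitRing.
End FormalPowerSeries.

Variant letter := La | Lb.

Definition is_La (c : letter) := if c is La then true else false.
Definition letter_of_bool (t : bool) := if t then La else Lb.
Lemma is_LaK : cancel is_La letter_of_bool. Proof. by case. Qed.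
HB.instance Definition _ := Finite.copy letter (can_type is_LaK).

Implicit Types u w : seq letter.

(* A mask of the same length as w is a set of positions of w. *)
Definition subword_count w u : nat :=
  #|[set m : (size w).-tuple bool | mask m w == u]|.

Definition sim2 u w : bool :=
  (count_mem La u == count_mem La w) &&
  (subword_count u [:: La; Lb] == subword_count w [:: La; Lb]).

Definition positions_a w : seq nat :=
  [seq p <- iota 0 (size w) | nth Lb w p == La].

(* The sequence r_1, r_2, ..., indexed from 0. *)
Definition bs_right w : seq nat :=
  [seq count_mem Lb (drop p.+1 w) | p <- positions_a w].

Definition tail (s : nat) w : seq nat :=
  take (minn s (count_mem La w)) (rev (bs_right w)).

Definition approx (s : nat) : rel (seq letter) :=
  fun u w => sim2 u w && (tail s u == tail s w).

Definition approx_classes (s n : nat) : {set {set n.-tuple letter}} :=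
  equivalence_partition (fun u w : n.-tuple letter => approx s u w) setT.

Definition num_singletons (s n : nat) : nat :=
  #|[set C in approx_classes s n | #|C| == 1]|.

Definition singleton_series (s : nat) : fps int :=
  Fps (fun n => (num_singletons s n)%:Z%R).

(* Main.v *)
Require Import Defs.
From mathcomp Require Import all_boot all_order all_algebra.
From mathcomp Require Import zify ring.
Import GRing.Theory.

(* Removing the last letter: the (s+1)-tail tells whether a word ends in a or
   in b; a word w a is alone in its (s+1)-class iff w is alone in its s-class,
   and w b is alone iff w is alone in its (s+1)-class. Hence
   (1 - x) S_(s+1) = 1 + x S_s, and only S_0 remains, i.e. the 2-binomial
   classes. There the classes with k letters a and m letters b are indexed by
   the number i <= k m of subwords ab, and the class of i is a singleton iff
   k <= 1, m <= 1, i <= 1 or i >= k m - 1. Summing over k + m = n gives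
   1, 2, 4 and then 6 n - 10 singletons. *)

(** * Counting scattered subwords when a letter is appended *)

Lemma big_rcons_tuple (T : finType) n (F : seq T -> nat) :
  \sum_(t : n.+1.-tuple T) F t
  = \sum_(t : n.-tuple T) \sum_(c : T) F (rcons t c).
Proof.
rewrite pair_big /=.
rewrite (reindex (fun p : n.-tuple T * T => [tuple of rcons p.1 p.2])) //=.
apply/onW_bij/inj_card_bij => [[t c] [t' c'] /(congr1 val) /= /rcons_inj|].
  by case=> /val_inj -> ->.
by rewrite card_prod !card_tuple expnSr.
Qed.

Lemma big_letter (F : letter -> nat) : \sum_(c : letter) F c = F La + F Lb.
Proof.
rewrite (bigD1 La) //= (bigD1 Lb) //= big1 ?addn0 // => c.
by case: c.
Qed.

Lemma subword_countE w u n : size w = n ->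
  subword_count w u = \sum_(m : n.-tuple bool) (mask m w == u).
Proof.
move=> <-; rewrite /subword_count -sum1dep_card big_mkcond /=.
by apply: eq_bigr => m _; case: eqP.
Qed.

(** The last bit of a mask decides whether the last letter [c] is selected; if it is, it must match
    [d] and the other bits select [u]. *)
Lemma subword_count_rcons w c u d :
  subword_count (rcons w c) (rcons u d)
  = subword_count w (rcons u d) + (c == d) * subword_count w u.
Proof.
rewrite (@subword_countE _ _ (size w).+1) ?size_rcons //.
rewrite (big_rcons_tuple _ _ (fun m => (mask m (rcons w c) == rcons u d) : nat)).
rewrite !(@subword_countE _ _ (size w)) // big_distrr -big_split /=.
apply: eq_bigr => m _; rewrite big_bool /= !mask_rcons ?size_tuple //.
by rewrite /= cats0 cats1 eqseq_rcons addnC; case: (c == d);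
  rewrite ?andbF ?andbT ?mul1n.
Qed.

Lemma subword_count0 w : subword_count w [::] = 1.
Proof.
elim/last_ind: w => [|w c IHw].
  rewrite (@subword_countE _ _ 0) // (eq_bigr (fun=> 1)) => [|m _].
    by rewrite sum1_card card_tuple.
  by rewrite tuple0.
rewrite -[RHS]IHw (@subword_countE _ _ (size w).+1) ?size_rcons //.
rewrite (big_rcons_tuple _ _ (fun m => (mask m (rcons w c) == [::]) : nat)).
rewrite (@subword_countE _ _ (size w)) //; apply: eq_bigr => m _.
rewrite big_bool /= !mask_rcons ?size_tuple // cats0 cats1.
by case: (mask m w).
Qed.

Lemma subword_count_nil u : subword_count [::] u = (u == [::]).
Proof.
rewrite (@subword_countE _ _ 0) // (eq_bigr (fun=> (u == [::]) : nat)) => [|m _].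
  by rewrite sum_nat_const card_tuple mul1n.
by rewrite tuple0 eq_sym.
Qed.

Lemma subword_count1 w d : subword_count w [:: d] = count_mem d w.
Proof.
elim/last_ind: w => [|w c IHw]; first exact: subword_count_nil.
rewrite -[[:: d]]/(rcons [::] d) subword_count_rcons IHw subword_count0.
by rewrite -cats1 count_cat /= addn0 muln1.
Qed.

Lemma count_La_rcons w c :
  count_mem La (rcons w c) = count_mem La w + (c == La).
Proof. by rewrite -cats1 count_cat /= addn0. Qed.

Local Notation count_ab w := (subword_count w [:: La; Lb]).

Lemma count_ab_rcons w c :
  count_ab (rcons w c) = count_ab w + (c == Lb) * count_mem La w.
Proof.
by rewrite -[[:: La; Lb]]/(rcons [:: La] Lb) subword_count_rcons subword_count1.
Qed.

(** * Tails when a letter is appended *)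

Lemma positions_a_rcons w c :
  positions_a (rcons w c)
  = positions_a w ++ (if c == La then [:: size w] else [::]).
Proof.
rewrite /positions_a size_rcons -addn1 iotaD filter_cat add0n /=.
rewrite nth_rcons ltnn eqxx; congr (_ ++ _).
apply: eq_in_filter => p; rewrite mem_iota /= add0n => lt_p.
by rewrite nth_rcons lt_p.
Qed.

(** A final a has no b to its right, while a final b lies to the right of every a. *)
Lemma bs_right_rcons w c :
  bs_right (rcons w c)
  = if c is La then rcons (bs_right w) 0 else map succn (bs_right w).
Proof.
have drop_w p : p \in positions_a w ->
    count_mem Lb (drop p.+1 (rcons w c)) = count_mem Lb (drop p.+1 w) + (c == Lb).
  rewrite mem_filter mem_iota /= => /andP[_ lt_p].
  by rewrite drop_rcons // -cats1 count_cat /= addn0.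
rewrite /bs_right positions_a_rcons map_cat (proj1 (eq_in_map _ _ _) drop_w).
case: c {drop_w} => /=.
  rewrite drop_oversize ?size_rcons //= cats1; congr rcons.
  by apply: eq_map => p; rewrite addn0.
by rewrite cats0 -map_comp; apply: eq_map => p /=; rewrite addn1.
Qed.

Lemma size_bs_right w : size (bs_right w) = count_mem La w.
Proof.
elim/last_ind: w => // w c IHw.
rewrite bs_right_rcons count_La_rcons -IHw.
by case: c; rewrite ?size_rcons ?size_map /= ?addn1 ?addn0.
Qed.

Lemma tailE s w : tail s w = take s (rev (bs_right w)).
Proof.
rewrite /tail minnE -size_bs_right -size_rev.
case: (leqP s (size (rev (bs_right w)))) => [le_s|/ltnW le_s].
  by congr take; lia.
by rewrite !take_oversize //; lia.
Qed.

Lemma tail_rcons_a s w : tail s.+1 (rcons w La) = 0 :: tail s w.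
Proof. by rewrite !tailE bs_right_rcons rev_rcons. Qed.

Lemma tail_rcons_b s w : tail s (rcons w Lb) = map succn (tail s w).
Proof. by rewrite !tailE bs_right_rcons -map_rev map_take. Qed.

(** * Classes and their sizes when the last letter is removed *)

Lemma approx_rcons_aa s u w : approx s.+1 (rcons u La) (rcons w La) = approx s u w.
Proof.
rewrite /approx /sim2 !tail_rcons_a !count_ab_rcons !count_La_rcons /=.
by rewrite eqn_add2r !mul0n !addn0 eqseq_cons.
Qed.

Lemma approx_rcons_bb s u w : approx s (rcons u Lb) (rcons w Lb) = approx s u w.
Proof.
rewrite /approx /sim2 !tail_rcons_b !count_ab_rcons !count_La_rcons /=.
rewrite !addn0 !mul1n (inj_eq (inj_map succn_inj)).
(* The final b adds the number of a's to each count of ab, and these numbers agree once the first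
   test holds. *)
by case: eqP => [->|//]; rewrite eqn_add2r.
Qed.

(** The first tail starts with 0; the second is empty or starts with a successor. *)
Lemma approx_rcons_ab s u w : approx s.+1 (rcons u La) (rcons w Lb) = false.
Proof.
rewrite /approx tail_rcons_a tail_rcons_b andbC.
by case: (tail s.+1 w).
Qed.

Lemma approx_sym s u w : approx s u w = approx s w u.
Proof. by rewrite /approx /sim2 eq_sym (eq_sym (count_ab u)) (eq_sym (tail s u)). Qed.

Lemma approx_equiv s n :
  {in [set: n.-tuple letter] & &,
    equivalence_rel (fun u w : n.-tuple letter => approx s u w)}.
Proof.
move=> u w v _ _ _; rewrite /approx /sim2 !eqxx; split=> //.
by case/andP=> /andP[/eqP-> /eqP->] /eqP->.
Qed.

(** The length [n] is separate from [w], so that [w] can be a plain list such as [rcons w c]. *)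
Definition class_size s n w := \sum_(u : n.-tuple letter) approx s u w.

Lemma num_singletonsE s n :
  num_singletons s n = \sum_(w : n.-tuple letter) (class_size s n w == 1).
Proof.
have partP := equivalence_partitionP (@approx_equiv s n).
rewrite /num_singletons -sum1dep_card -/(approx_classes s n) in partP *.
have -> : \sum_(w : n.-tuple letter) (class_size s n w == 1)
    = \sum_(w in [set: n.-tuple letter]) (#|pblock (approx_classes s n) w| == 1).
  apply: eq_big => [w|w _]; first by rewrite inE.
  congr (nat_of_bool (_ == 1)); rewrite /class_size -sum1_card [RHS]big_mkcond.
  apply: eq_bigr => u _; rewrite pblock_equivalence_partition ?inE //.
    by rewrite approx_sym; case: (approx _ _ _).
  exact: approx_equiv.
(* Grouping the words by class, a class C contributes #|C| if #|C| = 1 and 0 otherwise, hence 1 for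
   each singleton. *)
rewrite (set_partition_big _ partP) big_mkcondr /=; apply: eq_bigr => C CP.
have [_ tiP _] := and3P partP.
rewrite (eq_bigr (fun=> (#|C| == 1) : nat)) => [|w wC].
  by rewrite sum_nat_const; case: eqP => [->|]; rewrite ?muln0.
by rewrite (def_pblock tiP CP wC).
Qed.

Lemma class_size_rcons_a s n w :
  class_size s.+1 n.+1 (rcons w La) = class_size s n w.
Proof.
rewrite /class_size (big_rcons_tuple _ _ (fun u => approx s.+1 u (rcons w La) : nat)).
apply: eq_bigr => u _.
by rewrite big_letter approx_rcons_aa (approx_sym _ (rcons u Lb)) approx_rcons_ab addn0.
Qed.

Lemma class_size_rcons_b s n w :
  class_size s.+1 n.+1 (rcons w Lb) = class_size s.+1 n w.
Proof.
rewrite /class_size (big_rcons_tuple _ _ (fun u => approx s.+1 u (rcons w Lb) : nat)).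
by apply: eq_bigr => u _; rewrite big_letter approx_rcons_bb approx_rcons_ab.
Qed.

Lemma num_singletons_rec s n :
  num_singletons s.+1 n.+1 = num_singletons s n + num_singletons s.+1 n.
Proof.
rewrite !num_singletonsE -big_split /=.
rewrite (big_rcons_tuple _ _ (fun w => (class_size s.+1 n.+1 w == 1) : nat)).
by apply: eq_bigr => w _; rewrite big_letter class_size_rcons_a class_size_rcons_b.
Qed.

Lemma sum_tuple0 (T : finType) (F : seq T -> nat) :
  \sum_(t : 0.-tuple T) F t = F [::].
Proof.
rewrite (eq_bigr (fun=> F [::])) => [|t _]; last by rewrite tuple0.
by rewrite sum_nat_const card_tuple mul1n.
Qed.

Lemma num_singletons_0 s : num_singletons s 0 = 1.
Proof.
rewrite num_singletonsE (sum_tuple0 _ (fun w => (class_size s 0 w == 1) : nat)).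
rewrite /class_size (sum_tuple0 _ (fun u => approx s u [::] : nat)).
by rewrite /approx /sim2 !eqxx.
Qed.

(** * Words with given numbers of a and ab: coefficients of Gaussian binomials *)

Definition num_words n k i := \sum_(w : n.-tuple letter)
  ((count_mem La w == k) && (count_ab w == i)).

Lemma num_words0 k i : num_words 0 k i = (k == 0) && (i == 0).
Proof.
rewrite /num_words (sum_tuple0 _
  (fun w => ((count_mem La w == k) && (count_ab w == i)) : nat)).
by rewrite subword_count_nil !(eq_sym 0).
Qed.

(** A final b forms ab with each of the k letters a. The factor [k <= i] guards the truncated
    subtraction. *)
Lemma num_words_rcons n k i :
  num_words n.+1 k i = (if k is k'.+1 then num_words n k' i else 0)
    + (k <= i) * num_words n k (i - k).
Proof.
have -> : num_words n.+1 k i =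
    \sum_(w : n.-tuple letter) ((count_mem La w).+1 == k) && (count_ab w == i)
    + \sum_(w : n.-tuple letter)
        (count_mem La w == k) && (count_ab w + k == i).
  rewrite /num_words (big_rcons_tuple _ _
    (fun w => ((count_mem La w == k) && (count_ab w == i)) : nat)) -big_split.
  apply: eq_bigr => w _; rewrite big_letter !count_ab_rcons !count_La_rcons /=.
  by rewrite !addn0 mul1n addn1; congr (_ + nat_of_bool _); case: eqP => // ->.
congr (_ + _); first by case: k => [|k]; [rewrite big1|].
rewrite /num_words big_distrr; apply: eq_bigr => w _ /=.
by case: eqP => //=; rewrite ?muln0 // => _; case: leqP; lia.
Qed.

Lemma num_words_eq0 n k i : n < k -> num_words n k i = 0.
Proof.
elim: n k i => [|n IHn] [|k] i // lt_nk; first by rewrite num_words0.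
by rewrite num_words_rcons !IHn ?muln0 //; lia.
Qed.

Lemma num_words_b n i : num_words n 0 i = (i == 0).
Proof.
elim: n i => [|n IHn] i; first by rewrite num_words0.
by rewrite num_words_rcons IHn subn0 mul1n.
Qed.

Lemma num_words_a n i : num_words n n i = (i == 0).
Proof.
elim: n i => [|n IHn] i; first by rewrite num_words0.
by rewrite num_words_rcons IHn num_words_eq0 ?muln0 ?addn0.
Qed.

(** The q-Pascal rule with both letter counts explicit, as the inductions on [k + m] below need
    it. *)
Lemma num_words_rec k m i :
  num_words (k.+1 + m.+1) k.+1 i = num_words (k + m.+1) k i
    + (k < i) * num_words (k.+1 + m) k.+1 (i - k.+1).
Proof. by rewrite addSn num_words_rcons addSnnS. Qed.

(** In the q-Pascal rule the summands are positive for i <= k (m + 1) and for k < i <= (k + 1) (m +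
    1); together these ranges leave no gap. *)
Lemma num_words_gt0 k m i : (0 < num_words (k + m) k i) = (i <= k * m).
Proof.
move: {2}(k + m) (leqnn (k + m)) => n.
elim: n k m i => [|n IHn] [|k] [|m] i le_n;
  rewrite ?addn0 ?num_words_a ?add0n ?num_words_b ?muln0 ?mul0n; try by case: i.
rewrite num_words_rec addn_gt0 muln_gt0 lt0b !IHn; lia.
Qed.

(** The condition passes to both summands of the q-Pascal rule, and it excludes the overlap k < i <=
    k (m + 1) where both are positive. *)
Lemma num_words_le1 k m i :
  [|| k <= 1, m <= 1, i <= 1 | k * m <= i.+1] -> num_words (k + m) k i <= 1.
Proof.
move: {2}(k + m) (leqnn (k + m)) => n.
elim: n k m i => [|n IHn] [|k] [|m] i le_n;
  rewrite ?addn0 ?num_words_a ?add0n ?num_words_b ?muln0 ?mul0n; try by case: i.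
rewrite num_words_rec mulSn mulnS => cond.
have leA : num_words (k + m.+1) k i <= 1 by apply: IHn; rewrite ?mulnS; lia.
have leB : num_words (k.+1 + m) k.+1 (i - k.+1) <= 1.
  by apply: IHn; rewrite ?mulSn; lia.
have gtA := num_words_gt0 k m.+1 i.
case: (ltnP k i) => lt_ki; last by rewrite mul0n addn0.
have [le_i|lt_i] := leqP i (k * m.+1); last by lia.
exfalso; rewrite mulnS in le_i; case: k {IHn leA leB gtA} cond le_n lt_ki le_i; nia.
Qed.

(** In the overlap k < i <= k (m + 1) both summands of the q-Pascal rule are positive. Below it the
    first summand satisfies the hypotheses again, above it the second does. *)
Lemma num_words_ge2 k m i :
  1 < k -> 1 < m -> 1 < i -> i.+1 < k * m -> 1 < num_words (k + m) k i.
Proof.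
move: {2}(k + m) (leqnn (k + m)) => n.
elim: n k m i => [|n IHn] [|k] [|m] i le_n // k_gt1 m_gt1 i_gt1.
rewrite num_words_rec mulSn mulnS => lt_i.
have gtA := num_words_gt0 k m.+1 i.
have gtB := num_words_gt0 k.+1 m (i - k.+1).
rewrite mulSn in gtB; rewrite mulnS in gtA.
case: (ltnP k i) => [lt_ki|le_ik]; last first.
  by rewrite mul0n addn0; apply: IHn => //; rewrite ?mulnS; nia.
have [le_i|lt_ikm] := leqP i (k + k * m); first by lia.
rewrite mul1n (leq_trans _ (leq_addl _ _)) //; apply: IHn => //; rewrite ?mulSn; nia.
Qed.

Lemma num_words_eq1 k m i : (num_words (k + m) k i == 1) =
  (i <= k * m) && [|| k <= 1, m <= 1, i <= 1 | k * m <= i.+1].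
Proof.
rewrite eqn_leq num_words_gt0 andbC; case: leqP => //= le_i.
apply/idP/idP => [|/num_words_le1 //]; apply: contraLR.
rewrite !negb_or -!ltnNge => /and4P[*].
exact: num_words_ge2.
Qed.

(** * Singleton 2-binomial classes, for fixed letter counts and then for fixed length *)

Definition num_unique k m := \sum_(i < (k * m).+1) (num_words (k + m) k i == 1).

Lemma num_unique_small k m : (k <= 1) || (m <= 1) -> num_unique k m = (k * m).+1.
Proof.
move=> le1; rewrite /num_unique (eq_bigr (fun=> 1)) => [|i _].
  by rewrite sum1_card card_ord.
by rewrite num_words_eq1 -ltnS ltn_ord; case/orP: le1 => ->; rewrite ?orbT.
Qed.

Lemma num_unique_big k m : 1 < k -> 1 < m -> num_unique k m = 4.
Proof.
(* The sum then has N + 4 terms: two split off at each end count 1, the N middle ones count 0. *)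
move=> k_gt1 m_gt1; have [N defN] : exists N, k * m = N.+3.
  by exists (k * m - 3); nia.
rewrite /num_unique (eq_bigr (fun i : 'I__ => ((i <= 1) || (N.+2 <= i)) : nat)).
  rewrite defN 2!big_ord_recl 2!big_ord_recr big1 /= => [|i _].
    by rewrite /bump /=; lia.
  by have := ltn_ord i; rewrite /bump /=; lia.
case=> i /= lt_i _; rewrite num_words_eq1 -ltnS lt_i defN.
by rewrite [k <= 1]leqNgt [m <= 1]leqNgt k_gt1 m_gt1.
Qed.

Lemma count_La_le n (w : n.-tuple letter) : count_mem La w <= n.
Proof. by rewrite -{2}(size_tuple w) count_size. Qed.

Lemma count_ab_le n (w : n.-tuple letter) :
  count_ab w <= count_mem La w * (n - count_mem La w).
Proof.
rewrite -num_words_gt0 subnKC ?count_La_le //.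
by rewrite /num_words (bigD1 w) //= !eqxx.
Qed.

Lemma num_singletons0E n :
  num_singletons 0 n = \sum_(k < n.+1) num_unique k (n - k).
Proof.
pose single k i : nat := num_words n k i == 1.
(* For each word the double sum has one nonzero indicator, at its own pair (k, i); exchanging sums
   then counts by pairs. *)
transitivity (\sum_(w : n.-tuple letter) \sum_(k < n.+1)
   \sum_(i < (k * (n - k)).+1)
     ((count_mem La w == k) && (count_ab w == i)) * single k i).
  rewrite num_singletonsE; apply: eq_bigr => w _.
  have lt_k : count_mem La w < n.+1 by rewrite ltnS count_La_le.
  have lt_i := count_ab_le _ w; rewrite -ltnS in lt_i.
  rewrite (bigD1 (Ordinal lt_k)) //= [X in _ + X]big1 ?addn0 => [|k]; last first.
    rewrite -val_eqE /= eq_sym => /negPf neq_k.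
    by rewrite big1 // => i _; rewrite neq_k.
  rewrite (bigD1 (Ordinal lt_i)) //= [X in _ + X]big1 ?addn0 => [|i]; last first.
    by rewrite -val_eqE /= eq_sym => /negPf ->; rewrite andbF.
  rewrite !eqxx mul1n; congr (nat_of_bool (_ == 1)).
  by apply: eq_bigr => u _; rewrite /approx /sim2 !tailE !take0 eqxx andbT.
rewrite exchange_big; apply: eq_bigr => k _ /=.
rewrite exchange_big /num_unique subnKC -1?ltnS //; apply: eq_bigr => i _ /=.
rewrite -big_distrl /= -/(num_words n k i) /single.
by case: eqP => [->|]; rewrite ?muln0.
Qed.

Lemma num_singletons0_ge3 n : num_singletons 0 n.+3 = 6 * n + 8.
Proof.
(* The indices k = 0, 1, n + 2, n + 3 give 1, n + 3, n + 3, 1; each of the n others gives 4. *)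
rewrite num_singletons0E 2!big_ord_recl 2!big_ord_recr /=.
rewrite (eq_bigr (fun=> 4)) => [|i _]; last first.
  have lt_i := ltn_ord i; rewrite num_unique_big // /bump /=; lia.
rewrite sum_nat_const card_ord !num_unique_small /bump /=; lia.
Qed.

Lemma num_singletons0_small n : n < 3 -> num_singletons 0 n = 2 ^ n.
Proof.
by case: n => [|[|[|//]]] _; rewrite num_singletons0E !big_ord_recl big_ord0
  !num_unique_small.
Qed.

(** * Generating functions *)

Local Open Scope ring_scope.

Lemma fcoefX0 (f : fps int) : fcoef (fpsX int * f) 0 = 0.
Proof. by rewrite [LHS]big_ord1 mul0r. Qed.

Lemma fcoefXS (f : fps int) n : fcoef (fpsX int * f) n.+1 = fcoef f n.
Proof.
rewrite [LHS]big_ord_recl mul0r add0r big_ord_recl mul1r big1 ?addr0 => [|i _].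
  by rewrite subSS subn0.
by rewrite mul0r.
Qed.

Lemma fcoefD (f g : fps int) n : fcoef (f + g) n = fcoef f n + fcoef g n.
Proof. by []. Qed.

Lemma fcoefN (f : fps int) n : fcoef (- f) n = - fcoef f n.
Proof. by []. Qed.

Lemma fcoef1 n : fcoef (1 : fps int) n = (n == 0%N)%:R.
Proof. by []. Qed.

Lemma fcoef_singleton_series s n :
  fcoef (singleton_series s) n = (num_singletons s n)%:Z.
Proof. by []. Qed.

Local Definition fcoefE :=
  (fcoefD, fcoefN, fcoefX0, fcoefXS, fcoef1, fcoef_singleton_series).

Lemma singleton_series_rec s :
  (1 - fpsX int) * singleton_series s.+1 = 1 + fpsX int * singleton_series s.
Proof.
rewrite mulrBl mul1r; apply: fpsP => -[|n]; rewrite !fcoefE.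
  by rewrite num_singletons_0.
by rewrite num_singletons_rec PoszD addrK.
Qed.

Lemma singleton_series0 (x := fpsX int) :
  (1 - x) ^+ 2 * singleton_series 0
  = (1 - x) + x * (1 + x) * (1 + 2%:R * x ^+ 2).
Proof.
have -> : (1 - x) ^+ 2 * singleton_series 0 = singleton_series 0
    - x * singleton_series 0 - x * singleton_series 0
    + x * (x * singleton_series 0) by ring.
(* Horner form, so that the shift rules for [fpsX] read off each coefficient. *)
have -> : (1 - x) + x * (1 + x) * (1 + 2%:R * x ^+ 2) =
    1 + x * (x * (1 + x * (1 + 1 + x * (1 + 1)))) by ring.
(* The right side has degree 4. From degree 5 on, the left side is a second difference of values of
   6 n + 8, hence 0. *)
apply: fpsP => -[|[|[|[|[|n]]]]];
  rewrite !fcoefE ?num_singletons0_ge3 ?num_singletons0_small //=.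
by lia.
Qed.

Lemma unit_1subX : 1 - fpsX int \is a GRing.unit.
Proof. by rewrite unfold_in /=. Qed.

Theorem theorem6 (s : nat) :
  let x : fps int := fpsX int in
  singleton_series s =
    \sum_(0 <= j < s.+1) x ^+ j / (1 - x) ^+ j.+1
    + x ^+ s.+1 * (1 + x) * (1 + 2%:R * x ^+ 2) / (1 - x) ^+ s.+2.
Proof.
move=> x; have Ux : 1 - x \is a GRing.unit := unit_1subX.
have xV : (1 - x) * (1 - x)^-1 = 1 by rewrite mulrV.
elim: s => [|s IHs].
  rewrite big_nat1 expr0 !expr1 mul1r.
  apply: (mulrI (unitrX 2 Ux)); rewrite singleton_series0 -/x.
  by rewrite [RHS]mulrDr [X in _ = _ + X]mulrC divrK ?unitrX // [in RHS]expr2 mulrK.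
apply: (mulrI Ux); rewrite singleton_series_rec -/x IHs.
(* After multiplication by 1 - x, the term j = 0 is the 1 of the recurrence and each later term is x
   times its predecessor in the formula for s. *)
rewrite [in RHS]big_nat_recl // expr0 expr1 mul1r [RHS]mulrDr.
rewrite [X in _ = X + _]mulrDr xV.
rewrite -addrA [in LHS]mulrDr; congr (_ + (_ + _)).
  rewrite !big_distrr /=; apply: eq_bigr => j _.
  (* Inserting 1 - x and its inverse on the left balances the powers of the inverse, so [ring] needs
     no cancellation. *)
  rewrite -!exprVn -[LHS](mulVKr Ux) !exprS; ring.
rewrite -!exprVn -[LHS](mulVKr Ux) !exprS; ring.
Qed.
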